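(* Let $\bar X$ be the graph with vertex set $\{\Sigma,\Delta,\Gamma_1,\Gamma_2\}\sqcup\{n\in\mathbb Z: n\ge -1\}$ and the following edges: $\Sigma$ is adjacent to every $n\ge 0$; $\Delta$ is adjacent to $-1$ and to every $n\ge 1$; $\Gamma_1$ is adjacent to every odd $n\ge1$; $\Gamma_2$ is adjacent to every even $n\ge 2$; and there are no other edges. Let $X$ be obtained from $\bar X$ by blowing up each vertex to an edge, i.e. $X$ has two adjacent vertices $v,\mathcal Cv$ for each vertex $v$ of $\bar X$, and both $v,\mathcal Cv$ are adjacent to both $w,\mathcal Cw$ whenever $v,w$ are adjacent in $\bar X$ (no other edges). Suppose that $\mathcal W$ is any $X$-graph such that $(X,\mathcal W)$ is a combinatorial HHS. Then $\mathcal W$ is bounded, and in particular cannot be quasi-isometric to $\mathcal Z$, where $\mathcal Z$ is a space quasi-isometric to $\mathbb R$.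
   Context: COMBINATORIAL HHS. Let $X$ be a simplicial graph; its simplices are its finite cliques (including $\emptyset$). For a simplex $\Delta$, the link $\mathrm{Lk}(\Delta)$ is the subgraph induced by the vertices not in $\Delta$ that are adjacent to all vertices of $\Delta$ (so $\mathrm{Lk}(\emptyset)=X$, and $\Delta$ is maximal iff $\mathrm{Lk}(\Delta)=\emptyset$). An $X$-graph is a graph $\mathcal W$ whose vertex set is the set of maximal simplices of $X$. The graph $X^{+\mathcal W}$ has vertex set $X^{(0)}$; two vertices are adjacent if they are adjacent in $X$ or belong respectively to two maximal simplices that are adjacent in $\mathcal W$. Graphs carry the path metric. Write $\Delta\sim\Delta'$ if $\mathrm{Lk}(\Delta)=\mathrm{Lk}(\Delta')$, and let $\mathrm{Sat}(\Delta)$ be the set of vertices contained in some simplex $\Delta'\sim\Delta$. Let $Y_\Delta$ be the subgraph of $X^{+\mathcal W}$ induced by $X^{(0)}\setminus\mathrm{Sat}(\Delta)$ and $\mathcal C(\Delta)$ the subgraph of $Y_\Delta$ induced by $\mathrm{Lk}(\Delta)^{(0)}$. The pair $(X,\mathcal W)$ is a combinatorial HHS if: (i) there is a bound on the length of chains $\mathrm{Lk}(\Delta_1)\subsetneq\dots\subsetneq\mathrm{Lk}(\Delta_i)$; (ii) there is $\delta$ such that for each non-maximal simplex $\Delta$, $\mathcal C(\Delta)$ is $\delta$-hyperbolic (in particular connected) and $(\delta,\delta)$-quasi-isometrically embedded in $Y_\Delta$; (iii) whenever $\Delta,\Sigma$ are non-maximal simplices for which there is a non-maximal simplex $\Gamma$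 with $\mathrm{Lk}(\Gamma)\subseteq\mathrm{Lk}(\Delta)\cap\mathrm{Lk}(\Sigma)$ and $\mathrm{diam}(\mathcal C(\Gamma))\ge\delta$, there is a simplex $\Pi\supseteq\Sigma$ with $\mathrm{Lk}(\Pi)\subseteq\mathrm{Lk}(\Delta)$ and such that every non-maximal simplex $\Gamma$ with $\mathrm{Lk}(\Gamma)\subseteq\mathrm{Lk}(\Delta)\cap\mathrm{Lk}(\Sigma)$ and $\mathrm{diam}(\mathcal C(\Gamma))\ge\delta$ satisfies $\mathrm{Lk}(\Gamma)\subseteq\mathrm{Lk}(\Pi)$; (iv) if $v,w$ are distinct non-adjacent vertices of $\mathrm{Lk}(\Delta)$, for some simplex $\Delta$, contained in $\mathcal W$-adjacent maximal simplices, then they are contained in $\mathcal W$-adjacent maximal simplices both containing $\Delta$. ''Bounded'' means of finite diameter. In the source, $\mathcal Z$ is a specific 2-dimensional CAT(0) cube complex, quasi-isometric to $\mathbb R$, whose hierarchically hyperbolic structure given by its hyperclosure has $\bar X$ as its minimal orthogonality graph (the graph of $\sqsubseteq$-minimal domains with edges given by orthogonality), each $\sqsubseteq$-minimal domain having a one-point coordinate space. *)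

(* Defs.v *)
From HB Require Import structures.
From mathcomp Require Import all_boot all_order all_algebra.
From mathcomp Require Import all_classical all_reals all_analysis.

Set Implicit Arguments.
Unset Strict Implicit.
Unset Printing Implicit Defensive.

Import Order.TTheory GRing.Theory Num.Theory.

Local Open Scope classical_set_scope.
Local Open Scope ring_scope.

(* Quasi-isometries, for distance functions allowed to take the value +oo. *)

Definition qi_embedding (R : realType) (A B : Type) (K C : R)
    (dA : A -> A -> \bar R) (dB : B -> B -> \bar R) (f : A -> B) : Prop :=
  [/\ 1 <= K, 0 <= C &
      forall x y, (K^-1%:E * dA x y - C%:E <= dB (f x) (f y))%E /\
                  (dB (f x) (f y) <= K%:E * dA x y + C%:E)%E].

Definition quasi_isometric (R : realType) (A B : Type)
    (dA : A -> A -> \bar R) (dB : B -> B -> \bar R) : Prop :=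
  exists (K C : R) (f : A -> B),
    qi_embedding K C dA dB f /\
    forall b, exists a, (dB b (f a) <= C%:E)%E.

Definition metric_dist (R : realType) (Z : metricType R) (x y : Z) : \bar R :=
  (mdist x y)%:E.

Definition real_dist (R : realType) (x y : R) : \bar R := `|x - y|%:E.

(* A graph is identified with its vertex set, equipped with the path metric;
   vertices in different components are at distance +oo. *)

Record graph (V : Type) : Type := Graph {
  adj : V -> V -> Prop;
  adj_sym : forall x y, adj x y -> adj y x;
  adj_irrefl : forall x, ~ adj x x
}.

Definition induced (V : Type) (G : graph V) (A : set V) : graph A :=
  @Graph A (fun x y => adj G (val x) (val y))
    (fun x y => @adj_sym V G (val x) (val y))
    (fun x => @adj_irrefl V G (val x)).

Definition walk (V : Type) (G : graph V) (p : nat -> V) (n : nat) : Prop :=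
  forall i, (i < n)%N -> adj G (p i) (p i.+1).

Definition gdist (R : realType) (V : Type) (G : graph V) (x y : V) : \bar R :=
  ereal_inf [set n%:R%:E | n in
    [set n : nat | exists p, [/\ walk G p n, p 0%N = x & p n = y]]].

Definition gdiam (R : realType) (V : Type) (G : graph V) : \bar R :=
  ereal_sup [set gdist R G x y | x in [set: V] & y in [set: V]].

Definition connected_graph (V : Type) (G : graph V) : Prop :=
  forall x y, exists p n, [/\ walk G p n, p 0%N = x & p n = y].

Definition geodesic (R : realType) (V : Type) (G : graph V)
    (p : nat -> V) (n : nat) : Prop :=
  walk G p n /\ gdist R G (p 0%N) (p n) = n%:R%:E.

(* Connected, with delta-slim geodesic triangles.  It suffices to constrain the
   side p: relabelling and reversing the sides gives the other two. *)
Definition hyperbolic (R : realType) (V : Type) (delta : R) (G : graph V) :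
    Prop :=
  connected_graph G /\
  forall (p q r : nat -> V) (a b c : nat),
    geodesic R G p a -> geodesic R G q b -> geodesic R G r c ->
    p 0%N = r 0%N -> p a = q 0%N -> q b = r c ->
    forall i, (i <= a)%N ->
      (exists2 j, (j <= b)%N & (gdist R G (p i) (q j) <= delta%:E)%E) \/
      (exists2 k, (k <= c)%N & (gdist R G (p i) (r k) <= delta%:E)%E).

Section CombinatorialHHS.
Variables (V : Type) (X : graph V).

Definition simplex (D : set V) : Prop :=
  finite_set D /\ forall v w, D v -> D w -> v <> w -> adj X v w.

Definition maximal_simplex : set (set V) :=
  [set D | simplex D /\ forall D', simplex D' -> D `<=` D' -> D' = D].

Definition nonmaximal_simplex (D : set V) : Prop :=
  simplex D /\ ~ maximal_simplex D.

Definition Lk (D : set V) : set V :=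
  [set v | ~ D v /\ forall w, D w -> adj X v w].

Definition Sat (D : set V) : set V :=
  [set v | exists D', [/\ simplex D', Lk D' = Lk D & D' v]].

Definition X_graph : Type := graph maximal_simplex.

Variable W : X_graph.

(* v and w belong respectively to two W-adjacent maximal simplices, both
   containing D. *)
Definition W_linked (D : set V) (v w : V) : Prop :=
  exists M N : maximal_simplex,
    [/\ adj W M N, val M v, val N w, D `<=` val M & D `<=` val N].

Definition plus_adj (v w : V) : Prop :=
  v <> w /\ (adj X v w \/ W_linked set0 v w).

Lemma plus_adj_sym v w : plus_adj v w -> plus_adj w v.
Proof.
case=> vw wadj; split; first exact: nesym.
case: wadj => [vw_adj|[M [N [MN Mv Nw _ _]]]]; first by left; exact: adj_sym.
by right; exists N, M; split=> //; exact: adj_sym.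
Qed.

Lemma plus_adj_irrefl v : ~ plus_adj v v.
Proof. by case. Qed.

Definition X_plus : graph V := Graph plus_adj_sym plus_adj_irrefl.

Definition Y (D : set V) : graph (~` Sat D) := induced X_plus (~` Sat D).

Definition C_vertices (D : set V) : set (~` Sat D) :=
  [set y | Lk D (val y)].
Arguments C_vertices : clear implicits.

Definition C (D : set V) : graph (C_vertices D) :=
  induced (Y D) (C_vertices D).

Definition bounded_link_chains : Prop :=
  exists N : nat, forall (k : nat) (c : nat -> set V),
    (forall i, (i < k)%N -> simplex (c i)) ->
    (forall i, (i.+1 < k)%N -> Lk (c i) `<` Lk (c i.+1)) ->
    (k <= N)%N.

Definition hyperbolic_links (R : realType) (delta : R) : Prop :=
  forall D, nonmaximal_simplex D ->
    hyperbolic delta (C D) /\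
    qi_embedding delta delta (gdist R (C D)) (gdist R (Y D))
      (fun x : C_vertices D => val x).

Definition large_common_nest (R : realType) (delta : R) (D S G : set V) :
    Prop :=
  [/\ nonmaximal_simplex G, Lk G `<=` Lk D `&` Lk S
    & (delta%:E <= gdiam R (C G))%E].

Definition link_intersections (R : realType) (delta : R) : Prop :=
  forall D S, nonmaximal_simplex D -> nonmaximal_simplex S ->
    (exists G, large_common_nest delta D S G) ->
    exists P, [/\ simplex P, S `<=` P, Lk P `<=` Lk D
      & forall G, large_common_nest delta D S G -> Lk G `<=` Lk P].

Definition edge_fullness : Prop :=
  forall D v w, simplex D -> Lk D v -> Lk D w -> v <> w -> ~ adj X v w ->
    W_linked set0 v w -> W_linked D v w.

Definition combinatorial_HHS (R : realType) : Prop :=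
  [/\ bounded_link_chains,
      exists delta : R, hyperbolic_links delta /\ link_intersections delta
    & edge_fullness].

End CombinatorialHHS.

Section Blowup.
Variables (V : Type) (G : graph V).

(* (v, false) is v, and (v, true) is Cv. *)
Definition blowup_adj (x y : V * bool) : Prop :=
  adj G x.1 y.1 \/ (x.1 = y.1 /\ x.2 <> y.2).

Lemma blowup_adj_sym x y : blowup_adj x y -> blowup_adj y x.
Proof.
case=> [xy_adj|[e ne]]; first by left; exact: adj_sym.
by right; split; [|exact: nesym].
Qed.

Lemma blowup_adj_irrefl x : ~ blowup_adj x x.
Proof. by case=> [xx|[_]]; [exact: adj_irrefl xx|apply]. Qed.

Definition blowup : graph (V * bool) :=
  Graph blowup_adj_sym blowup_adj_irrefl.

End Blowup.

Inductive Xbar_vertex : Type :=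
  | vSigma | vDelta | vGamma1 | vGamma2
  | vInt of {n : int | -1 <= n}.

Definition Xbar_edge (a b : Xbar_vertex) : Prop :=
  match a, b with
  | vSigma, vInt n => 0 <= val n
  | vDelta, vInt n => val n = -1 \/ 1 <= val n
  | vGamma1, vInt n => 1 <= val n /\ ~~ (2 %| val n)%Z
  | vGamma2, vInt n => 2 <= val n /\ (2 %| val n)%Z
  | _, _ => False
  end.

Definition Xbar_adj (a b : Xbar_vertex) : Prop := Xbar_edge a b \/ Xbar_edge b a.

Lemma Xbar_adj_sym a b : Xbar_adj a b -> Xbar_adj b a.
Proof. by case; [right|left]. Qed.

Lemma Xbar_adj_irrefl a : ~ Xbar_adj a a.
Proof. by case: a => [||||n] []. Qed.

Definition Xbar : graph Xbar_vertex := Graph Xbar_adj_sym Xbar_adj_irrefl.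

(* Main.v *)
(* Maximal simplices of the blow-up are (blown-up) edges of the triangle-free
   graph Xbar, so W is a graph on the edges of Xbar.  Write F(a) for the
   simplex {a, Ca}, whose link is the blow-up of the neighbours of a.  By edge
   fullness, a path in C(F(a)) from c to c' gives a W-path, no longer, from the
   edge ac to the edge ac'.  A simplex containing F(Sigma) whose link lies in
   Lk(F(Delta)) cannot have two neighbours of Gamma_i in its link, so the axiom
   on intersections of links forces diam C(F(Gamma_i)) < delta: the edges at
   Gamma_1, and those at Gamma_2, form W-bounded sets.  For n >= 1 the vertex n
   has exactly three neighbours and C(F(n)) is connected, so every edge at n is
   uniformly W-close to the edge from n to some Gamma_i.  Connectedness of
   C(F(Sigma)) and C(F(Delta)) ties together the finitely many remaining pieces. *)
Require Import Defs.
From HB Require Import structures.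
From mathcomp Require Import all_boot all_order all_algebra.
From mathcomp Require Import all_classical all_reals all_analysis.
From mathcomp Require Import zify lra.

Set Implicit Arguments.
Unset Strict Implicit.
Unset Printing Implicit Defensive.

Import Order.TTheory GRing.Theory Num.Theory.

Local Open Scope classical_set_scope.
Local Open Scope ring_scope.

Lemma adjC (V : Type) (G : graph V) x y : adj G x y <-> adj G y x.
Proof. by split; exact: adj_sym. Qed.

Lemma adj_neq (V : Type) (G : graph V) x y : adj G x y -> x <> y.
Proof. by move=> xy e; move: xy; rewrite e; exact: adj_irrefl. Qed.

(** * Lazy walks and the path metric *)

Section DistLe.
Variables (V : Type) (G : graph V).

(* Lazy walks, so that the relation is monotone in k. *)
Fixpoint dist_le (k : nat) (x y : V) : Prop :=
  if k is k'.+1 then exists z, (x = z \/ adj G x z) /\ dist_le k' z y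
  else x = y.

Lemma dist_le_refl k x : dist_le k x x.
Proof. by elim: k => //= k IH; exists x; split; [left|]. Qed.

Lemma dist_le_trans k l x y z :
  dist_le k x y -> dist_le l y z -> dist_le (k + l) x z.
Proof.
elim: k x => [x -> //|k IH x [t [xt ty]] yz].
by exists t; split=> //; exact: IH ty yz.
Qed.

Lemma dist_le_adj x y : adj G x y -> dist_le 1 x y.
Proof. by move=> xy; exists y; split; [right|]. Qed.

Lemma dist_le_sym k x y : dist_le k x y -> dist_le k y x.
Proof.
elim: k x => [x -> //|k IH x [z [xz /IH yz]]].
rewrite -addn1; apply: dist_le_trans yz _; exists x; split=> //.
by case: xz => [->|xz]; [left|right; exact: adj_sym].
Qed.

Lemma dist_le_leq k l x y : (k <= l)%N -> dist_le k x y -> dist_le l x y.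
Proof.
by move=> kl xy; rewrite -(subnKC kl); apply: dist_le_trans xy _; exact: dist_le_refl.
Qed.

Lemma dist_le_walk k x y : dist_le k x y ->
  exists p n, [/\ (n <= k)%N, walk G p n, p 0%N = x & p n = y].
Proof.
elim: k x => [x ->|k IH x [z [xz /IH[p [n [nk wp pz py]]]]]].
  by exists (fun=> y), 0%N; split.
case: xz => [->|xz]; first by exists p, n; split=> //; exact: leqW.
exists (fun i => if i is j.+1 then p j else x), n.+1; split=> //.
by case=> [_|i /wp //]; rewrite pz.
Qed.

Lemma gdist_le (R : realType) k x y :
  dist_le k x y -> (gdist R G x y <= k%:R%:E)%E.
Proof.
case/dist_le_walk=> p [n [nk wp px py]].
apply: (@le_trans _ _ n%:R%:E); last by rewrite lee_fin ler_nat.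
by apply: ereal_inf_lbound; exists n => //; exists p.
Qed.

(** The strict bound on the infimum produces an actual walk; its length is a natural number below
    [r], hence at most the truncation of [r] plus one. *)
Lemma gdist_lt_walk (R : realType) (r : R) x y : (gdist R G x y < r%:E)%E ->
  exists p n, [/\ (n <= (Num.truncn r).+1)%N, walk G p n, p 0%N = x & p n = y].
Proof.
case/ereal_inf_lt=> _ [n [p [wp px py] <-]]; rewrite lte_fin => nr.
exists p, n; split=> //; rewrite -(ler_nat R) ltW //.
exact: lt_trans nr (truncnS_gt r).
Qed.

End DistLe.

(** A link is disjoint from the saturation: a vertex in some [D'] with the same link as [D] cannot
    lie in that link. *)
Lemma Lk_vertex (V : Type) (X : graph V) (D : set V) v :
  Lk X D v -> exists x : @C_vertices V X D, val (val x) = v.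
Proof.
move=> Dv; have nSv : (~` Sat X D) v.
  by case=> D' [_ eqLk D'v]; move: Dv; rewrite -eqLk => -[].
have Cy : @C_vertices V X D (exist _ v (mem_set nSv)) by [].
by exists (SigSub (mem_set Cy)).
Qed.

(** * Simplices and links in the blow-up of a triangle-free graph *)

Section TriangleFreeBlowup.
Variables (V : Type) (G : graph V).
Hypothesis triangle_free : forall a b c, adj G a b -> adj G b c -> ~ adj G a c.
Hypothesis no_isolated : forall a, exists b, adj G a b.

Definition fiber (a : V) : set (V * bool) := [set x | x.1 = a].
Definition edge_simplex (a b : V) : set (V * bool) := fiber a `|` fiber b.

Lemma edge_simplexC a b : edge_simplex a b = edge_simplex b a.
Proof. exact: setUC. Qed.

Lemma finite_fiber a : finite_set (fiber a).
Proof.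
apply: (@sub_finite_set _ _ ([set (a, false)] `|` [set (a, true)])).
  by case=> b [] /= <-; [right|left].
by rewrite finite_setU; split; exact: finite_set1.
Qed.

Lemma simplex_edge a b : adj G a b -> simplex (blowup G) (edge_simplex a b).
Proof.
move=> ab; split; first by rewrite /edge_simplex finite_setU; split; exact: finite_fiber.
move=> v w; rewrite /edge_simplex /fiber /= /blowup_adj => va wb vw.
have diff_bool : v.1 = w.1 -> v.2 <> w.2.
  by move=> e1 e2; apply: vw; rewrite [v]surjective_pairing e1 e2 -surjective_pairing.
have ba : adj G b a by exact: adj_sym.
by case: va wb => [va|vb] [wa|wb]; [right|left|left|right];
  rewrite ?va ?vb ?wa ?wb //; split=> //; apply: diff_bool; congruence.
Qed.

Lemma simplex_sub D D' : simplex (blowup G) D -> D' `<=` D ->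
  simplex (blowup G) D'.
Proof.
move=> [finD cD] sD; split; first exact: sub_finite_set sD finD.
by move=> v w /sD Dv /sD Dw; exact: cD.
Qed.

Lemma simplex_fiber a : simplex (blowup G) (fiber a).
Proof.
have [b ab] := no_isolated a.
by apply: simplex_sub (simplex_edge ab) _ => x; left.
Qed.

Lemma simplex_base D x y : simplex (blowup G) D -> D x -> D y ->
  x.1 = y.1 \/ adj G x.1 y.1.
Proof.
move=> [_ cD] Dx Dy; have [->|/(cD _ _ Dx Dy)[]] := pselect (x = y).
- by left.
- by right.
- by case; left.
Qed.

(** A vertex of [D] over a third base point would form a triangle with [a] and [b]. *)
Lemma simplex_sub_edge D a b : adj G a b -> simplex (blowup G) D ->
  (exists i, D (a, i)) -> (exists j, D (b, j)) -> D `<=` edge_simplex a b.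
Proof.
move=> ab sD [i Da] [j Db] x Dx.
have [/= xa|xa] := simplex_base sD Dx Da; first by left.
have [/= xb|/= xb] := simplex_base sD Dx Db; first by right.
by case: (triangle_free xa ab).
Qed.

Lemma maximal_edge a b : adj G a b ->
  maximal_simplex (blowup G) (edge_simplex a b).
Proof.
move=> ab; split; first exact: simplex_edge.
move=> D' sD' sub; rewrite eqEsubset; split=> //.
apply: simplex_sub_edge => //; exists true; apply: sub; first by left.
by right.
Qed.

(** Two vertices of [M] over distinct base points determine the edge; otherwise [M] lies in one
    fiber and any neighbour completes it. The point of [V] rules out the empty graph, where the
    empty simplex is maximal. *)
Lemma maximal_simplexP M : maximal_simplex (blowup G) M -> V ->
  exists a b, adj G a b /\ M = edge_simplex a b.
Proof.
move=> [sM maxM] v0.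
suff [a [b [ab sub]]] : exists a b, adj G a b /\ M `<=` edge_simplex a b.
  by exists a, b; split=> //; rewrite (maxM _ (simplex_edge ab) sub).
have [[x Mx]|M0] := pselect (exists x, M x); last first.
  have [b ab] := no_isolated v0; exists v0, b; split=> // x Mx.
  by case: M0; exists x.
have [[y [My xy]]|Mfib] := pselect (exists y, M y /\ x.1 <> y.1).
  have [//|ab] := simplex_base sM Mx My.
  exists x.1, y.1; split=> //; apply: simplex_sub_edge => //.
    by exists x.2; rewrite -surjective_pairing.
  by exists y.2; rewrite -surjective_pairing.
have [b ab] := no_isolated x.1; exists x.1, b; split=> // y My; left.
by apply: contrapT => ne; apply: Mfib; exists y; split=> // /esym.
Qed.

Lemma maximal_simplex_edge M a x : maximal_simplex (blowup G) M ->
  fiber a `<=` M -> M x -> x.1 <> a -> M = edge_simplex a x.1.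
Proof.
move=> maxM aM Mx xa; have [c [d [cd eM]]] := maximal_simplexP maxM a.
have : M (a, false) by exact: aM.
move: Mx; rewrite eM => -[]/= <- []/= e; rewrite -?e //;
  by [case: xa|rewrite edge_simplexC].
Qed.

Lemma Lk_fiber a x : Lk (blowup G) (fiber a) x <-> adj G x.1 a.
Proof.
split=> [[xa adjx]|xa]; last first.
  by split=> [|w wa]; [exact: adj_neq xa|left; rewrite wa].
by case: (adjx (a, false)) => //= -[].
Qed.

Lemma nonmaximal_fiber a : nonmaximal_simplex (blowup G) (fiber a).
Proof.
split; first exact: simplex_fiber.
case=> _ maxa; have [b ab] := no_isolated a.
have : edge_simplex a b (b, true) by right.
rewrite (maxa _ (simplex_edge ab)); last by move=> x; left.
by move/esym; exact: adj_neq ab.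
Qed.

(** * From paths in the fiber links to paths in [W] *)

Variable W : X_graph (blowup G).

(** Stated on plain sets, so that edges can be rewritten without carrying proofs of maximality; it
    forces [A] and [B] to be maximal simplices. *)
Definition simplex_dist_le (k : nat) (A B : set (V * bool)) : Prop :=
  exists M N, [/\ val M = A, val N = B & dist_le W k M N].

Lemma simplex_dist_le_refl k a b : adj G a b ->
  simplex_dist_le k (edge_simplex a b) (edge_simplex a b).
Proof.
move=> ab; have M := maximal_edge ab.
exists (SigSub (mem_set M)), (SigSub (mem_set M)).
by split=> //; exact: dist_le_refl.
Qed.

Lemma simplex_dist_le_trans k l A B C :
  simplex_dist_le k A B -> simplex_dist_le l B C -> simplex_dist_le (k + l) A C.
Proof.
case=> M [N [MA NB MN]] [N' [P [N'B PC NP]]].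
exists M, P; split=> //; apply: dist_le_trans MN _.
by rewrite (_ : N = N') //; apply: val_inj; rewrite NB N'B.
Qed.

Lemma simplex_dist_le_sym k A B : simplex_dist_le k A B -> simplex_dist_le k B A.
Proof. by case=> M [N [? ? MN]]; exists N, M; split=> //; exact: dist_le_sym. Qed.

Lemma simplex_dist_le_leq k l A B :
  (k <= l)%N -> simplex_dist_le k A B -> simplex_dist_le l A B.
Proof.
by move=> kl [M [N [MA NB MN]]]; exists M, N; split=> //; exact: dist_le_leq MN.
Qed.

Hypothesis full : edge_fullness W.

(** Over equal base points the two edges coincide. Otherwise triangle-freeness makes [v] and [w]
    non-adjacent in the blow-up, so their adjacency comes from [W], and edge fullness moves it to
    maximal simplices containing [fiber a]. *)
Lemma plus_adj_fiber a v w :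
  Lk (blowup G) (fiber a) v -> Lk (blowup G) (fiber a) w -> plus_adj W v w ->
  simplex_dist_le 1 (edge_simplex a v.1) (edge_simplex a w.1).
Proof.
move=> av aw [ne vw'].
have /Lk_fiber va := av; have /Lk_fiber wa := aw.
have [e|ne1] := pselect (v.1 = w.1).
  by rewrite -e; apply: simplex_dist_le_refl; exact: adj_sym.
have nadj : ~ adj (blowup G) v w.
  by case=> [|[]//] vw1; exact: (triangle_free vw1 wa va).
have {vw'} lnk : W_linked W set0 v w by case: vw'.
have [M [N [MN Mv Nw aM aN]]] :=
  full (simplex_fiber a) av aw ne nadj lnk.
exists M, N; split; last exact: dist_le_adj.
- apply: (maximal_simplex_edge (set_valP M) aM Mv).
  exact: adj_neq va.
- apply: (maximal_simplex_edge (set_valP N) aN Nw).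
  exact: adj_neq wa.
Qed.

Lemma adj_C_fiber a (x y : @C_vertices _ (blowup G) (fiber a)) :
  adj (C W (fiber a)) x y ->
  simplex_dist_le 1 (edge_simplex a (val (val x)).1)
                    (edge_simplex a (val (val y)).1).
Proof.
move=> xy; apply: plus_adj_fiber; [exact: (set_valP x)|exact: (set_valP y)|].
exact: xy.
Qed.

Lemma walk_C_fiber a p n : walk (C W (fiber a)) p n ->
  simplex_dist_le n (edge_simplex a (val (val (p 0%N))).1)
                    (edge_simplex a (val (val (p n))).1).
Proof.
elim: n => [_|n IH wp].
  apply: simplex_dist_le_refl; apply: adj_sym; apply/Lk_fiber.
  exact: (set_valP (p 0%N)).
rewrite -addn1; apply: (@simplex_dist_le_trans _ _ _ (edge_simplex a (val (val (p n))).1)).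
  by apply: IH => i /leqW; exact: wp.
by rewrite addn1; apply: adj_C_fiber; exact: wp.
Qed.

Lemma fiber_vertex a c : adj G a c ->
  exists x : @C_vertices _ (blowup G) (fiber a), val (val x) = (c, false).
Proof. by move=> ac; apply: Lk_vertex; apply/Lk_fiber; exact: adj_sym. Qed.

Lemma connected_fiber_dist_le a c d : connected_graph (C W (fiber a)) ->
  adj G a c -> adj G a d ->
  exists k, simplex_dist_le k (edge_simplex a c) (edge_simplex a d).
Proof.
move=> conn /fiber_vertex[x xc] /fiber_vertex[y yd].
have [p [n [wp p0 pn]]] := conn x y; exists n.
by have := walk_C_fiber wp; rewrite p0 pn xc yd.
Qed.

(** A walk from [c] to [d] must at some step leave the fiber over [c]. A mere neighbour of
    [(c, false)] would not do, since it could be its twin [(c, true)]. *)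
Lemma connected_fiber_neighbor a c d : connected_graph (C W (fiber a)) ->
  adj G a c -> adj G a d -> c <> d ->
  exists e, [/\ adj G a e, c <> e &
    simplex_dist_le 1 (edge_simplex a c) (edge_simplex a e)].
Proof.
move=> conn /fiber_vertex[x xc] /fiber_vertex[y yd] cd.
have [p [n [wp p0 pn]]] := conn x y.
(* The endpoint is only remembered to lie off [c], so that the induction can shorten the walk. *)
have {}pn : (val (val (p n))).1 <> c by rewrite pn yd => /esym.
elim: n wp pn => [|n IH] wp pn; first by case: pn; rewrite p0 xc.
have [e|ne] := pselect ((val (val (p n))).1 = c); last first.
  by apply: IH ne => i /leqW; exact: wp.
exists (val (val (p n.+1))).1; split; last 2 first.
- exact: nesym.
- by rewrite -e; apply: adj_C_fiber; exact: wp.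
- by apply: adj_sym; apply/Lk_fiber; exact: (set_valP (p n.+1)).
Qed.

(** A graph on three vertices without isolated vertices is connected of diameter at most 2. *)
Lemma three_neighbors_dist_le a x y z : connected_graph (C W (fiber a)) ->
  x <> y -> y <> z -> x <> z ->
  (forall b, adj G a b <-> [\/ b = x, b = y | b = z]) ->
  forall b c, adj G a b -> adj G a c ->
    simplex_dist_le 2 (edge_simplex a b) (edge_simplex a c).
Proof.
move=> conn xy yz xz nbr.
have ax : adj G a x by apply/nbr; constructor 1.
have ay : adj G a y by apply/nbr; constructor 2.
have az : adj G a z by apply/nbr; constructor 3.
pose E := edge_simplex a; pose near b c := simplex_dist_le 1 (E b) (E c).
have S b c : near b c -> near c b by exact: simplex_dist_le_sym.
have T b c d : near b c -> near c d -> simplex_dist_le 2 (E b) (E d).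
  exact: simplex_dist_le_trans.
have rfl b : adj G a b -> near b b by exact: simplex_dist_le_refl.
have Ex : near x y \/ near x z.
  have [e [/nbr[] -> ne]] := connected_fiber_neighbor conn ax ay xy;
    by [case: ne|left|right].
have Ey : near y x \/ near y z.
  have [e [/nbr[] -> ne]] := connected_fiber_neighbor conn ay az yz;
    by [case: ne|left|right].
have Ez : near z x \/ near z y.
  have [e [/nbr[] -> ne]] := connected_fiber_neighbor conn az ax (nesym xz);
    by [case: ne|left|right].
have [nx ny nz] : [/\ near x x, near y y & near z z] by split; exact: rfl.
move=> b c /nbr[] -> /nbr[] ->; first [exact: T nx nx|exact: T ny ny|
  exact: T nz nz|idtac];
  case: Ex => ?; case: Ey => ?; case: Ez => ?; eauto 4.
Qed.

(** * Small diameter from the axiom on intersections of links *)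

Section SmallLink.
Variables (R : realType) (delta : R).

(** If the diameter were large, the axiom would give a simplex [P] containing [fiber s] whose link
    lies between those of [fiber g] and [fiber d]. Either [P] is too big to have both [c] and [c']
    in its link, or it equals [fiber s] and has [e] in its link. *)
Lemma gdiam_fiber_lt s d g c c' e :
  link_intersections W delta ->
  (forall b, adj G g b -> adj G s b /\ adj G d b) ->
  adj G g c -> adj G g c' -> c <> c' -> adj G s e -> ~ adj G d e ->
  (gdiam R (C W (fiber g)) < delta%:E)%E.
Proof.
move=> inter sub gc gc' cc' se de; rewrite ltNge; apply/negP => big.
have nest : large_common_nest W delta (fiber d) (fiber s) (fiber g).
  split=> //; first exact: nonmaximal_fiber.
  move=> v /Lk_fiber/adjC gv; have [sv dv] := sub _ gv.
  by split; apply/Lk_fiber; exact: adj_sym.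
have [P [sP sub_sP LkP Lk_sub]] := inter _ _
  (nonmaximal_fiber d) (nonmaximal_fiber s) (ex_intro _ _ nest).
have {Lk_sub}LkgP := Lk_sub _ nest.
have [[x [Px xs]]|Pfib] := pselect (exists x, P x /\ x.1 <> s).
  have sx : adj G s x.1.
    have Ps : P (s, false) by exact: sub_sP.
    by have [/= e'|] := simplex_base sP Ps Px; [case: xs|].
  (* Such a [b] is adjacent to [s], as is [x.1]; were [b] adjacent to [x.1], there would be a
     triangle. *)
  have eqx b : adj G g b -> b = x.1.
    move=> gb; have [] : Lk (blowup G) P (b, false).
      by apply: LkgP; apply/Lk_fiber; exact: adj_sym.
    move=> _ /(_ _ Px)[/= bx|[]//].
    by case: (triangle_free (proj1 (sub _ gb)) bx).
  by apply: cc'; rewrite (eqx c) // (eqx c').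
have eP : P = fiber s.
  rewrite eqEsubset; split=> // x Px; apply: contrapT => xs.
  by apply: Pfib; exists x.
have Pe : Lk (blowup G) P (e, false).
  by rewrite eP; apply/Lk_fiber; exact: adj_sym.
by apply: de; apply: adj_sym; exact: (iffLR (Lk_fiber _ _) (LkP _ Pe)).
Qed.

Lemma gdiam_fiber_dist_le g :
  (gdiam R (C W (fiber g)) < delta%:E)%E ->
  forall c d, adj G g c -> adj G g d ->
  simplex_dist_le (Num.truncn delta).+1 (edge_simplex g c) (edge_simplex g d).
Proof.
move=> small c d gc gd.
have [x xc] := fiber_vertex gc; have [y yd] := fiber_vertex gd.
have : (gdist R (C W (fiber g)) x y < delta%:E)%E.
  by apply: le_lt_trans small; apply: ereal_sup_ubound; exists x => //; exists y.
move=> xy; have [p [n [nk wp p0 pn]]] := gdist_lt_walk xy.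
by have := simplex_dist_le_leq nk (walk_C_fiber wp); rewrite p0 pn xc yd.
Qed.

End SmallLink.
End TriangleFreeBlowup.

(** * Boundedness under quasi-isometry *)

Lemma quasi_isometric_bounded (R : realType) (A B : Type)
    (dA : A -> A -> \bar R) (d : B -> B -> R) (D : R) :
  (forall x y, d x y = d y x) ->
  (forall x y z, d x z <= d x y + d y z) ->
  (forall x y, (dA x y <= D%:E)%E) ->
  quasi_isometric dA (fun x y => (d x y)%:E) ->
  exists D' : R, forall x y, d x y <= D'.
Proof.
move=> dC dT dA_le [K [C [f [[K1 C0 qi] dense]]]].
(* Each of [x] and [y] is within [C] of an image point, and image points are within [K * D + C] of
   each other. *)
exists (C + (K * D + C) + C) => x y.
have [a] := dense x; have [b] := dense y; rewrite !lee_fin => yb xa.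
have fab : d (f a) (f b) <= K * D + C.
  rewrite -lee_fin EFinD EFinM; have [_ /le_trans] := qi a b; apply.
  by rewrite leeD2r // lee_wpmul2l // lee_fin (le_trans ler01).
apply: (le_trans (dT x (f b) y)); rewrite lerD //; last by rewrite dC.
by apply: (le_trans (dT x (f a) (f b))); rewrite lerD.
Qed.

(** Boundedness would pass from [A] to [Z] and then to the real line. *)
Lemma bounded_not_quasi_line (R : realType) (A : Type) (dA : A -> A -> \bar R)
    (D : R) (Z : metricType R) :
  (forall x y, (dA x y <= D%:E)%E) ->
  quasi_isometric (metric_dist (R := R) (Z := Z)) (real_dist (R := R)) ->
  ~ quasi_isometric dA (metric_dist (R := R) (Z := Z)).
Proof.
move=> dA_le ZR AZ.
have [D' Zb] : exists D' : R, forall x y : Z, mdist x y <= D'.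
  apply: quasi_isometric_bounded dA_le AZ; last exact: metric_triangle.
  exact: metric_sym.
have [D'' Rb] : exists D'' : R, forall x y : R, `|x - y| <= D''.
  apply: quasi_isometric_bounded ZR; [exact: distrC|move=> x y z; exact: ler_distD|].
  by move=> x y; rewrite lee_fin; exact: Zb.
have := Rb (`|D''| + 1) 0; rewrite subr0 ger0_norm ?addr_ge0 // => le1.
by have := ler_norm D''; lra.
Qed.

(** * Adjacency in the graph [Xbar] *)

Definition vneg1 : Xbar_vertex := vInt (exist _ (-1) (lexx (-1))).

Definition vint (k : nat) : Xbar_vertex :=
  vInt (exist _ k%:Z (le_trans (lerN10 _) (le0z_nat k))).

(** Indexing by parity gives one name to the Gamma-neighbour of every positive integer. *)
Definition vGamma (k : nat) : Xbar_vertex := if odd k then vGamma1 else vGamma2.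

Lemma vIntP n : vInt n = vneg1 \/ exists k, vInt n = vint k.
Proof.
case: n => -[k|[|k]] n1; last by [].
- by right; exists k; congr vInt; exact: val_inj.
- by left; congr vInt; exact: val_inj.
Qed.

(** The graph is bipartite: every edge joins one of the four named vertices to an integer. *)
Lemma Xbar_triangle_free a b c :
  adj Xbar a b -> adj Xbar b c -> ~ adj Xbar a c.
Proof.
by case: a => [||||n]; case: b => [||||m]; case: c => [||||k] [] // _ [] // _ [].
Qed.

Lemma adj_Sigma k : adj Xbar vSigma (vint k).
Proof. by left. Qed.

Lemma adj_Delta k : adj Xbar vDelta (vint k.+1).
Proof. by left; right. Qed.

Lemma adj_Delta_neg1 : adj Xbar vDelta vneg1.
Proof. by left; left. Qed.

Lemma dvd2_Posz (k : nat) : (2 %| k%:Z)%Z = ~~ odd k.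
Proof. exact: dvdn2. Qed.

Lemma adj_vGamma k : adj Xbar (vGamma k.+1) (vint k.+1).
Proof.
by rewrite /vGamma; case: ifP => k_odd; left; split; rewrite ?dvd2_Posz ?k_odd //;
  case: k k_odd.
Qed.

Lemma adj_vint k b : adj Xbar (vint k.+1) b <->
  [\/ b = vSigma, b = vDelta | b = vGamma k.+1].
Proof.
split=> [[]|[] ->]; last 3 first.
- exact/adjC/adj_Sigma.
- exact/adjC/adj_Delta.
- exact/adjC/adj_vGamma.
- by case: b.
case: b => [||||n] //=; first by constructor 1.
- by constructor 2.
- move=> [_]; rewrite dvd2_Posz negbK => k_odd.
  by constructor 3; rewrite /vGamma k_odd.
- move=> [_]; rewrite dvd2_Posz => /negbTE k_odd.
  by constructor 3; rewrite /vGamma k_odd.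
Qed.

Lemma adj_vGamma_inv j b : adj Xbar (vGamma j) b -> exists k, b = vint k.+1.
Proof.
case: b => [||||n]; try by rewrite /vGamma; case: ifP => _ [].
have [->|[[|k] ->]] := vIntP n; try by rewrite /vGamma; case: ifP => _ [] [].
by exists k.
Qed.

Lemma Xbar_no_isolated a : exists b, adj Xbar a b.
Proof.
case: a => [||||n].
- by exists (vint 0); exact: adj_Sigma.
- by exists vneg1; exact: adj_Delta_neg1.
- by exists (vint 1); exact: (adj_vGamma 0).
- by exists (vint 2); exact: (adj_vGamma 1).
have [->|[k ->]] := vIntP n; first by exists vDelta; exact/adjC/adj_Delta_neg1.
by exists vSigma; exact/adjC/adj_Sigma.
Qed.

(** Each edge has an integer endpoint, and -1 and 0 have a single neighbour each, namely Delta and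
    Sigma. *)
Lemma Xbar_edgeP a b : adj Xbar a b ->
  [\/ edge_simplex a b = edge_simplex vSigma (vint 0),
      edge_simplex a b = edge_simplex vDelta vneg1 |
      exists k c, adj Xbar (vint k.+1) c /\
        edge_simplex a b = edge_simplex (vint k.+1) c].
Proof.
move=> ab; wlog [n an] : a b ab / exists n, a = vInt n.
  move=> wl; have [aE|bE] : (exists n, a = vInt n) \/ (exists n, b = vInt n).
  - by case: a b ab => [||||n] [||||m] [] // _; by [left; exists n|right; exists m].
  - exact: wl.
  - by rewrite edge_simplexC; apply: wl => //; exact: adj_sym.
move: ab; rewrite {a}an.
have [->|[[|k] ->]] := vIntP n => ab.
- have -> : b = vDelta by case: b ab => [||||m] [] // [].
  by constructor 2; exact: edge_simplexC.
- have -> : b = vSigma by case: b ab => [||||m] [] // [].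
  by constructor 1; exact: edge_simplexC.
- by constructor 3; exists k, b.
Qed.

(** * The uniform bound on [W] *)

Lemma combinatorial_HHS_dist_le (R : realType) (W : X_graph (blowup Xbar)) :
  combinatorial_HHS W R -> exists k, forall M N, dist_le W k M N.
Proof.
case=> _ [delta [hyp inter]] full.
have tf := Xbar_triangle_free; have iso := Xbar_no_isolated.
pose E := @edge_simplex Xbar_vertex; pose sdl := simplex_dist_le W.
have EC a b : E a b = E b a by exact: edge_simplexC.
have conn a : connected_graph (C W (fiber a)).
  by case: (hyp _ (nonmaximal_fiber iso a)) => -[].
pose K := (Num.truncn delta).+1.
have gamma j : (0 < j)%N -> forall c d, adj Xbar (vGamma j) c ->
    adj Xbar (vGamma j) d -> sdl K (E (vGamma j) c) (E (vGamma j) d).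
  case: j => // j _ c d jc jd.
  apply: (gdiam_fiber_dist_le tf iso full) jc jd.
  (* The integers [j + 1] and [j + 3] have the same parity, so both are neighbours of this Gamma; 0
     is adjacent to Sigma but not to Delta. *)
  apply: (@gdiam_fiber_lt _ _ tf iso W R delta vSigma vDelta (vGamma j.+1)
    (vint j.+1) (vint j.+3) (vint 0)) => //.
  - by move=> b /adj_vGamma_inv[k ->]; split; [exact: adj_Sigma|exact: adj_Delta].
  - exact: adj_vGamma.
  - have <- : vGamma j.+3 = vGamma j.+1 by rewrite /vGamma /= negbK.
    exact: adj_vGamma.
  - by case; lia.
  - exact: adj_Sigma.
  - by case=> // -[].
have star k b c : adj Xbar (vint k.+1) b -> adj Xbar (vint k.+1) c ->
    sdl 2%N (E (vint k.+1) b) (E (vint k.+1) c).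
  apply: (three_neighbors_dist_le tf iso full (conn _) _ _ _ (adj_vint k)) => //.
  - by rewrite /vGamma; case: ifP.
  - by rewrite /vGamma; case: ifP.
have cdist a c d := @connected_fiber_dist_le _ _ tf iso W full a c d (conn a).
have [k1 d1] := cdist _ _ _ (adj_Sigma 2) (adj_Sigma 1).
have [k2 d2] := cdist _ _ _ (adj_Sigma 0) (adj_Sigma 1).
have [k3 d3] := cdist _ _ _ adj_Delta_neg1 (adj_Delta 0).
(* The summands are the costs of turning around [k + 1], moving along its Gamma to [j], turning
   around [j], and moving along Sigma to 1. *)
pose K1 := (2 + K + 2 + k1)%N.
have main k b : adj Xbar (vint k.+1) b ->
    sdl K1 (E (vint k.+1) b) (E vSigma (vint 1)).
  (* Here [j] is 1 or 2, whichever has the parity of [k + 1]; only these two values need a path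
     along Sigma, so [k1] is independent of [k]. *)
  move=> kb; pose j := (~~ odd k.+1).+1%N.
  have jk : vGamma j = vGamma k.+1 by rewrite /vGamma /j; case: (odd k.+1).
  have aS i : adj Xbar (vint i) vSigma by exact/adjC/adj_Sigma.
  have aG i : adj Xbar (vint i.+1) (vGamma i.+1) by exact/adjC/adj_vGamma.
  have s1 : sdl 2%N (E (vint k.+1) b) (E (vint k.+1) (vGamma k.+1)).
    exact: star.
  have s2 : sdl K (E (vGamma k.+1) (vint k.+1)) (E (vGamma k.+1) (vint j)).
    by apply: gamma => //; [|rewrite -jk]; exact: adj_vGamma.
  have s3 : sdl 2%N (E (vint j) (vGamma j)) (E (vint j) vSigma).
    exact: star.
  have s4 : sdl k1 (E vSigma (vint j)) (E vSigma (vint 1)).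
    rewrite /j; case: (odd k.+1); last exact: d1.
    exact: (simplex_dist_le_refl tf W k1 (adj_Sigma 1)).
  apply: simplex_dist_le_trans s4; rewrite (EC vSigma).
  apply: simplex_dist_le_trans s3; rewrite (EC _ (vGamma j)) jk.
  by apply: simplex_dist_le_trans s2; rewrite (EC (vGamma _)).
(* [k2] handles the edge from Sigma to 0, and [k3 + K1] the edge from Delta to -1, which first moves
   along Delta to 1; the sum dominates every case. *)
pose L := (k2 + (k3 + K1))%N.
have base a b : adj Xbar a b -> sdl L (E a b) (E vSigma (vint 1)).
  rewrite /E => /Xbar_edgeP[->|->|[k [c [kc ->]]]].
  - by apply: simplex_dist_le_leq d2; rewrite /L; lia.
  - apply: (@simplex_dist_le_leq _ _ W (k3 + K1)); first by rewrite /L; lia.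
    apply: simplex_dist_le_trans d3 _; rewrite edge_simplexC.
    by apply: main; exact/adjC/adj_Delta.
  - by apply: simplex_dist_le_leq (main _ _ kc); rewrite /L; lia.
(* Both edges are joined through the reference edge from Sigma to 1. *)
exists (L + L)%N => M N.
have [a [b [ab ME]]] := maximal_simplexP tf iso (set_valP M) vSigma.
have [c [d [cd NE]]] := maximal_simplexP tf iso (set_valP N) vSigma.
have [M' [N' [MM NN MN]]] :=
  simplex_dist_le_trans (base _ _ ab) (simplex_dist_le_sym (base _ _ cd)).
have <- : M' = M by apply: val_inj; rewrite MM; exact: esym ME.
by have <- : N' = N by apply: val_inj; rewrite NN; exact: esym NE.
Qed.

Theorem proposition10p19 (R : realType) (W : X_graph (blowup Xbar)) :
  combinatorial_HHS W R ->
  (gdiam R W < +oo)%E /\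
  (forall Z : metricType R,
     quasi_isometric (metric_dist (R := R) (Z := Z)) (real_dist (R := R)) ->
     ~ quasi_isometric (gdist R W) (metric_dist (R := R) (Z := Z))).
Proof.
move=> /combinatorial_HHS_dist_le[k Wk].
have dW M N : (gdist R W M N <= k%:R%:E)%E by exact/gdist_le/Wk.
split; last by move=> Z; exact: bounded_not_quasi_line dW.
apply: (@le_lt_trans _ _ k%:R%:E); last exact: ltry.
by apply: ge_ereal_sup => _ [M _ [N _ <-]].
Qed.
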